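(* Let $\mathcal H_1,\mathcal H_2$ be finite-dimensional complex Hilbert spaces, let $|\varphi_1\rangle,\dots,|\varphi_n\rangle\in\mathcal H_1$ be unit vectors, let $\sigma_1,\dots,\sigma_n$ be density operators on $\mathcal H_2$, and let $\eta_1,\dots,\eta_n\in[0,1]$. Put $\Gamma=\mathrm{diag}\{\eta_1,\dots,\eta_n\}$, $\sqrt{\Gamma}=\mathrm{diag}\{\sqrt{\eta_1},\dots,\sqrt{\eta_n}\}$, and $X_{ij}=\langle\varphi_i|\varphi_j\rangle$. Then the states $|\varphi_1\rangle,\dots,|\varphi_n\rangle$ can be transformed to the corresponding states $\sigma_1,\dots,\sigma_n$ with success probability matrix $\Gamma$ if and only if there exist a finite-dimensional Hilbert space $\mathcal H_a$ and purifications $|\phi_1\rangle,\dots,|\phi_n\rangle\in\mathcal H_2\otimes\mathcal H_a$ of $\sigma_1,\dots,\sigma_n$, respectively, such that $$X-\sqrt{\Gamma}\,Y\sqrt{\Gamma}^{\dagger}\ \ge\ 0,\qquad\text{where } Y_{ij}=\langle\phi_i|\phi_j\rangle .$$ Moreover, if the input states are chosen with prior probabilities $p_1,\dots,p_n\ge 0$, $\sum_i p_i=1$, then the whole success probability of such a transformation is $P=\sum_i p_i\eta_i$.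
   Context: A physically accessible operation from $\mathcal H_1$ to $\mathcal H_2$ is a completely positive trace non-increasing map $\xi$ from operators on $\mathcal H_1$ to operators on $\mathcal H_2$, i.e. $\xi(\rho)=\sum_k M_k\rho M_k^\dagger$ with $\sum_k M_k^\dagger M_k\le I$. The states $|\varphi_i\rangle$ ''can be transformed to $\sigma_i$ with success probability matrix $\Gamma=\mathrm{diag}\{\eta_1,\dots,\eta_n\}$'' means that there is a single such map $\xi$ with $\xi(|\varphi_i\rangle\langle\varphi_i|)=\eta_i\sigma_i$ for all $i$. A purification of $\sigma_i$ in $\mathcal H_2\otimes\mathcal H_a$ is a unit vector $|\phi_i\rangle$ with $\mathrm{Tr}_a(|\phi_i\rangle\langle\phi_i|)=\sigma_i$, where $\mathrm{Tr}_a$ is the partial trace over $\mathcal H_a$. The success probability on an input state $\rho$ is $\mathrm{Tr}\,\xi(\rho)$, and the whole success probability for input states $\rho_i$ with priors $p_i$ is $P=\sum_i p_i\,\mathrm{Tr}\,\xi(\rho_i)$. $M\ge 0$ means $M$ is Hermitian positive semidefinite. *)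

(* Defs.v *)
From mathcomp Require Import all_boot all_order all_algebra.
From mathcomp Require Import sesquilinear spectral complex reals.
From mathcomp Require mxtens.

Set Implicit Arguments.
Unset Strict Implicit.
Unset Printing Implicit Defensive.

Import Order.TTheory GRing.Theory Num.Theory.
Local Open Scope ring_scope.
Local Open Scope sesquilinear_scope.
Local Open Scope complex_scope.

(* The Hilbert space of dimension d is 'cV[R[i]]_d with its standard inner
   product, conjugate-linear on the left; operators are matrices acting on
   column vectors, and A ^t* is the adjoint of A. *)
Definition braket (R : realType) (d : nat) (u v : 'cV[R[i]]_d) : R[i] :=
  (u ^t* *m v) ord0 ord0.

Definition unit_vector (R : realType) (d : nat) (u : 'cV[R[i]]_d) : Prop :=
  braket u u = 1.

Definition ketbra (R : realType) (d : nat) (u : 'cV[R[i]]_d) : 'M[R[i]]_d :=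
  u *m u ^t*.

Definition gram (R : realType) (d n : nat) (v : 'I_n -> 'cV[R[i]]_d) :
    'M[R[i]]_n :=
  \matrix_(i, j) braket (v i) (v j).

(* The order on R[i] is partial: 0 <= z says that z is real and nonnegative. *)
Definition psdmx (R : realType) (n : nat) (A : 'M[R[i]]_n) : Prop :=
  A \is hermsymmx /\ forall v : 'cV[R[i]]_n, 0 <= braket v (A *m v).

Definition density (R : realType) (d : nat) (sigma : 'M[R[i]]_d) : Prop :=
  psdmx sigma /\ \tr sigma = 1.

(* The Kraus form is the definition of a completely positive trace
   non-increasing map used here. *)
Definition operation (R : realType) (d1 d2 : nat)
    (xi : 'M[R[i]]_d1 -> 'M[R[i]]_d2) : Prop :=
  exists (m : nat) (M : 'I_m -> 'M[R[i]]_(d2, d1)),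
    psdmx (1%:M - \sum_k (M k) ^t* *m M k) /\
    forall rho, xi rho = \sum_k M k *m rho *m (M k) ^t*.

Definition transforms (R : realType) (d1 d2 n : nat)
    (xi : 'M[R[i]]_d1 -> 'M[R[i]]_d2) (phi : 'I_n -> 'cV[R[i]]_d1)
    (sigma : 'I_n -> 'M[R[i]]_d2) (eta : 'I_n -> R) : Prop :=
  operation xi /\ forall i, xi (ketbra (phi i)) = (eta i)%:C *: sigma i.

(* The tensor product of spaces of dimensions d and a is 'cV_(d * a), where
   mxtens_index (i, k) is the index of the basis vector |i> (x) |k>, as in the
   Kronecker product of mxtens; ptrace traces out the second factor. *)
Definition ptrace (R : realType) (d a : nat) (A : 'M[R[i]]_(d * a)) :
    'M[R[i]]_d :=
  \matrix_(i, j)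
    \sum_(k < a) A (mxtens.mxtens_index (i, k)) (mxtens.mxtens_index (j, k)).

Definition purification (R : realType) (d a : nat) (sigma : 'M[R[i]]_d)
    (psi : 'cV[R[i]]_(d * a)) : Prop :=
  unit_vector psi /\ ptrace (ketbra psi) = sigma.

Definition sqrt_diag (R : realType) (n : nat) (eta : 'I_n -> R) : 'M[R[i]]_n :=
  diag_mx (\row_i (Num.sqrt (eta i))%:C).

Definition success_prob (R : realType) (d1 d2 : nat)
    (xi : 'M[R[i]]_d1 -> 'M[R[i]]_d2) (rho : 'M[R[i]]_d1) : R[i] :=
  \tr (xi rho).

Definition whole_success_prob (R : realType) (d1 d2 n : nat)
    (xi : 'M[R[i]]_d1 -> 'M[R[i]]_d2) (p : 'I_n -> R)
    (rho : 'I_n -> 'M[R[i]]_d1) : R[i] :=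
  \sum_i (p i)%:C * success_prob xi (rho i).

(* Main.v *)
(** An operation with Kraus operators M_k is the partial trace of the map
    phi |-> V phi, where V = sum_k M_k (x) |k> satisfies V^* V = sum_k M_k^* M_k
    <= 1.  So the transformation exists iff some contraction V sends each phi_i
    to sqrt(eta_i) psi_i with psi_i a purification of sigma_i; and a contraction
    sending the columns of A to those of B exists iff A^* A - B^* B >= 0
    (Douglas). *)
Require Import Defs.
From mathcomp Require Import all_boot all_order all_algebra.
From mathcomp Require Import sesquilinear spectral complex reals.
From mathcomp Require mxtens.

Set Implicit Arguments.
Unset Strict Implicit.
Unset Printing Implicit Defensive.

Import Order.TTheory GRing.Theory Num.Theory.
Local Open Scope ring_scope.
Local Open Scope sesquilinear_scope.
Local Open Scope complex_scope.

(** * Algebra of the adjoint *)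

Section Adjoint.
Variable C : numClosedFieldType.

Lemma trmxC_mul m n p (A : 'M[C]_(m, n)) (B : 'M_(n, p)) :
  (A *m B) ^t* = B ^t* *m A ^t*.
Proof. by rewrite trmx_mul map_mxM. Qed.

Lemma trmxC_add m n (A B : 'M[C]_(m, n)) : (A + B) ^t* = A ^t* + B ^t*.
Proof. by rewrite linearD /= map_mxD. Qed.

Lemma trmxC_sub m n (A B : 'M[C]_(m, n)) : (A - B) ^t* = A ^t* - B ^t*.
Proof. by rewrite linearB /= map_mxB. Qed.

Lemma trmxC_scale m n (a : C) (A : 'M[C]_(m, n)) :
  (a *: A) ^t* = a^* *: A ^t*.
Proof. by rewrite linearZ /= map_mxZ. Qed.

Lemma trmxC_1 n : (1%:M : 'M[C]_n) ^t* = 1%:M.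
Proof. by rewrite trmx1 map_mx1. Qed.

Lemma hermsymmxP n (A : 'M[C]_n) : reflect (A ^t* = A) (A \is hermsymmx).
Proof.
by apply: (iffP (is_hermitianmxP _ _ _)); rewrite expr0 scale1r; apply: esym.
Qed.

End Adjoint.

(** * Positive semidefinite matrices and Douglas factorization *)

Section PositiveSemidefinite.
Variable R : realType.
Local Notation C := R[i].

Lemma braket_ge0 d (u : 'cV[C]_d) : 0 <= braket u u.
Proof.
by rewrite /braket mxE sumr_ge0 // => k _; rewrite !mxE mulrC mul_conjC_ge0.
Qed.

Lemma braket_eq0 d (u : 'cV[C]_d) : braket u u = 0 -> u = 0.
Proof.
rewrite /braket mxE => /psumr_eq0P u0; apply/matrixP=> i j; rewrite ord1 mxE.
have: (u ^t*) ord0 i * u i ord0 = 0.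
  by apply: u0 => // k _; rewrite !mxE mulrC mul_conjC_ge0.
by rewrite !mxE mulrC => /eqP; rewrite mul_conjC_eq0 => /eqP.
Qed.

Lemma braket_mulmx d e (A : 'M[C]_(e, d)) (u v : 'cV[C]_d) :
  braket (A *m u) (A *m v) = braket u (A ^t* *m A *m v).
Proof. by rewrite /braket trmxC_mul !mulmxA. Qed.

Lemma gram_factor d n (v : 'I_n -> 'cV[C]_d) (V := \matrix_(i, j) v j i ord0) :
  gram v = V ^t* *m V.
Proof.
apply/matrixP=> i j; rewrite /gram /braket !mxE.
by apply: eq_bigr => k _; rewrite !mxE.
Qed.

Lemma psdmx_congr m n (A : 'M[C]_m) (B : 'M[C]_(m, n)) :
  psdmx A -> psdmx (B ^t* *m A *m B).
Proof.
move=> [/hermsymmxP hA pA]; split.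
  by apply/hermsymmxP; rewrite !trmxC_mul trmxCK hA mulmxA.
by move=> v; have := pA (B *m v); rewrite /braket trmxC_mul !mulmxA.
Qed.

(** Diagonalize [A] as P^* D P with P unitary; positivity makes D nonnegative, and B = P^* sqrt(D)
    works. *)
Lemma psdmx_factor d (A : 'M[C]_d) :
  psdmx A -> exists B : 'M[C]_d, B *m B ^t* = A.
Proof.
move=> [hA pA]; have /orthomx_spectralP := hermitian_normalmx hA.
set P := spectralmx A; set D := spectral_diag A => AE.
have Pu : P \is unitarymx := spectral_unitarymx A.
rewrite invmx_unitary // in AE.
(* Evaluating the quadratic form of [A] at the eigenvector P^* e_i gives exactly the i-th
   eigenvalue. *)
have D_ge0 i : 0 <= D ord0 i.
  have := pA (P ^t* *m delta_mx i ord0).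
  rewrite {1}AE /braket trmxC_mul trmxCK !mulmxA -[_ *m P *m P ^t*]mulmxA.
  rewrite (unitarymxP Pu) mulmx1 -[_ *m P *m P ^t*]mulmxA.
  rewrite (unitarymxP Pu) mulmx1.
  rewrite mul_mx_diag mxE (bigD1 i) //= big1 => [|j ji]; last first.
    by rewrite !mxE (negPf ji) mulr0.
  by rewrite !mxE !eqxx rmorph1 mul1r mulr1 addr0.
exists (P ^t* *m diag_mx (map_mx sqrtC D)).
rewrite trmxC_mul trmxCK AE !mulmxA; congr (_ *m _).
rewrite -mulmxA; congr (_ *m _).
rewrite tr_diag_mx map_diag_mx mulmx_diag; congr diag_mx.
apply/rowP=> i; rewrite !mxE.
by rewrite /= geC0_conj ?sqrtC_ge0 // -expr2 sqrtCK.
Qed.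

(** The hypothesis says |B u| <= |A u| for all u, so A u |-> B u is well defined and contractive on
    the range of [A]; it is extended by zero on the orthogonal complement. With H a generalized
    inverse of G = A^* A, this extension is V = B H A^*. *)
Lemma contraction_exists d e n (A : 'M[C]_(d, n)) (B : 'M[C]_(e, n)) :
  psdmx (A ^t* *m A - B ^t* *m B) ->
  exists2 V : 'M[C]_(e, d), V *m A = B & psdmx (1%:M - V ^t* *m V).
Proof.
move=> [_ leBA]; set G := A ^t* *m A.
have le_norm (u : 'cV_n) : braket (B *m u) (B *m u) <= braket (A *m u) (A *m u).
  rewrite -subr_ge0 !braket_mulmx; move: (leBA u).
  by rewrite /braket mulmxBl mulmxBr mxE [X in _ + X]mxE.
have kerA (u : 'cV_n) : G *m u = 0 -> A *m u = 0.
  by move=> Gu; apply: braket_eq0; rewrite braket_mulmx Gu /braket mulmx0 mxE.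
have kerB (u : 'cV_n) : G *m u = 0 -> B *m u = 0.
  move=> /kerA Au; apply: braket_eq0; apply/le_anti; rewrite braket_ge0 andbT.
  by rewrite (le_trans (le_norm u)) // Au /braket mulmx0 mxE.
(* The kernel inclusions for vectors, applied column by column, become implications between matrix
   equations. *)
have ker_mx p q (M : 'M[C]_(q, n)) (D : 'M[C]_(n, p)) :
    (forall u : 'cV_n, G *m u = 0 -> M *m u = 0) -> G *m D = 0 -> M *m D = 0.
  move=> kerM GD; apply/matrixP=> i j.
  have := kerM (col j D); rewrite colE !mulmxA GD mul0mx.
  move=> /(_ erefl)/colP/(_ i).
  by rewrite -colE [LHS]mxE [RHS]mxE => ->; rewrite mxE.
have [H GHG] : exists H, G *m H *m G = G by exists (pinvmx G); rewrite mulmxKpV.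
have hG : G ^t* = G by rewrite trmxC_mul trmxCK.
(* [H] need not be Hermitian, but since [G] is, H^* is a generalized inverse of [G] as well. *)
have GHtG : G *m H ^t* *m G = G.
  by have /(congr1 (fun M => M ^t*)) := GHG;
    rewrite trmxC_mul [(G *m H) ^t*]trmxC_mul hG mulmxA.
(* The columns of 1 - H G lie in the kernel of [G], hence in that of [B]. *)
have BHG : B *m (H *m G) = B.
  apply/eqP; rewrite eq_sym -subr_eq0 -[X in X - _]mulmx1 -mulmxBr; apply/eqP.
  by apply: ker_mx kerB _; rewrite mulmxBr mulmx1 mulmxA GHG subrr.
have AHtG : A *m (H ^t* *m G) = A.
  apply/eqP; rewrite eq_sym -subr_eq0 -[X in X - _]mulmx1 -mulmxBr; apply/eqP.
  by apply: ker_mx kerA _; rewrite mulmxBr mulmx1 mulmxA GHtG subrr.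
have GHA : G *m H *m A ^t* = A ^t*.
  by have /(congr1 (fun M => M ^t*)) := AHtG;
    rewrite trmxC_mul [(_ *m G) ^t*]trmxC_mul trmxCK hG.
exists (B *m H *m A ^t*); first by rewrite -!mulmxA -/G BHG.
split; first by apply/hermsymmxP; rewrite trmxC_sub trmxC_1 trmxC_mul trmxCK.
move=> w; set V := B *m H *m A ^t*.
have -> : braket w ((1%:M - V ^t* *m V) *m w) =
    braket w w - braket (V *m w) (V *m w).
  by rewrite braket_mulmx /braket mulmxBl mul1mx mulmxBr mxE [X in _ + X]mxE.
(* [A u] is the orthogonal projection of [w] on the range of [A]. *)
have [u [z [wE Az ->]]] : exists u : 'cV_n, exists z,
    [/\ w = A *m u + z, A ^t* *m z = 0 & V *m w = B *m u].
  pose u := H *m A ^t* *m w; exists u, (w - A *m u); split.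
  - by rewrite addrC subrK.
  - by rewrite mulmxBr !mulmxA GHA subrr.
  - by rewrite /V /u !mulmxA.
have zA : z ^t* *m A = 0.
  by rewrite -[_ *m A]trmxCK trmxC_mul trmxCK Az trmx0 map_mx0.
(* Pythagoras, z being orthogonal to the range of [A]. Hence |w|^2 - |V w|^2 = (|A u|^2 - |B u|^2) +
   |z|^2. *)
have w_norm : braket w w = braket (A *m u) (A *m u) + braket z z.
  rewrite /braket {1 2}wE trmxC_add !mulmxDl !mulmxDr.
  rewrite trmxC_mul -[_ *m A ^t* *m z]mulmxA Az mulmx0 addr0.
  by rewrite [z ^t* *m (A *m u)]mulmxA zA mul0mx add0r mxE.
by rewrite w_norm addrAC addr_ge0 ?braket_ge0 // subr_ge0.
Qed.

End PositiveSemidefinite.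

(** * Kraus operators, partial traces and purifications *)

Section Stinespring.
Variable R : realType.
Local Notation C := R[i].

(* [kraus_part V k] is (1 (x) <k|) V. *)
Definition kraus_part d a p (V : 'M[C]_(d * a, p)) (k : 'I_a) : 'M[C]_(d, p) :=
  \matrix_(i, j) V (mxtens.mxtens_index (i, k)) j.

(** This is sum_k M_k (x) |k>, the Stinespring operator of the family. *)
Definition stack d a p (M : 'I_a -> 'M[C]_(d, p)) : 'M[C]_(d * a, p) :=
  \matrix_(x, j)
    M (mxtens.mxtens_unindex x).2 (mxtens.mxtens_unindex x).1 j.

Lemma stackK d a p (M : 'I_a -> 'M[C]_(d, p)) k : kraus_part (stack M) k = M k.
Proof. by apply/matrixP=> i j; rewrite !mxE mxtens.mxtens_indexK. Qed.

Lemma sum_mxtens_index d a (F : 'I_(d * a) -> C) :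
  \sum_x F x = \sum_k \sum_i F (mxtens.mxtens_index (i, k)).
Proof.
rewrite (reindex _ (onW_bij _ (Bijective (@mxtens.mxtens_indexK d a)
                                 (@mxtens.mxtens_unindexK d a)))) /=.
by rewrite exchange_big pair_big; apply: eq_bigr => -[i k].
Qed.

(** Resolution of the identity on the ancilla; it turns the trace condition on Kraus operators into
    contractivity of [V]. *)
Lemma kraus_part_gram d a p (V : 'M[C]_(d * a, p)) :
  \sum_k (kraus_part V k) ^t* *m kraus_part V k = V ^t* *m V.
Proof.
apply/matrixP=> i j; rewrite summxE !mxE sum_mxtens_index.
apply: eq_bigr => k _; by rewrite !mxE; apply: eq_bigr => l _; rewrite !mxE.
Qed.

Lemma kraus_part_mul d a p q (V : 'M[C]_(d * a, p)) (A : 'M[C]_(p, q)) k :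
  kraus_part (V *m A) k = kraus_part V k *m A.
Proof.
by apply/matrixP=> i j; rewrite !mxE; apply: eq_bigr => l _; rewrite !mxE.
Qed.

Lemma ptrace_ketbraE d a (u : 'cV[C]_(d * a)) :
  ptrace (ketbra u) = \sum_k ketbra (kraus_part u k).
Proof.
apply/matrixP=> i j; rewrite mxE summxE; apply: eq_bigr => k _.
by rewrite !mxE; apply: eq_bigr => l _; rewrite !mxE.
Qed.

Lemma ptrace_ketbra_mul d a p (V : 'M[C]_(d * a, p)) (v : 'cV[C]_p) :
  ptrace (ketbra (V *m v)) =
  \sum_k kraus_part V k *m ketbra v *m (kraus_part V k) ^t*.
Proof.
rewrite ptrace_ketbraE; apply: eq_bigr => k _.
by rewrite kraus_part_mul /ketbra trmxC_mul !mulmxA.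
Qed.

Lemma ketbra_scale d (c : C) (u : 'cV[C]_d) :
  ketbra (c *: u) = (c * c^*) *: ketbra u.
Proof. by rewrite /ketbra trmxC_scale -scalemxAl -scalemxAr scalerA. Qed.

Lemma ptrace_scale d a (c : C) (A : 'M[C]_(d * a)) :
  ptrace (c *: A) = c *: ptrace A.
Proof.
apply/matrixP=> i j; rewrite !mxE mulr_sumr.
by apply: eq_bigr => k _; rewrite mxE.
Qed.

Lemma tr_ptrace_ketbra d a (u : 'cV[C]_(d * a)) :
  \tr (ptrace (ketbra u)) = braket u u.
Proof.
rewrite ptrace_ketbraE raddf_sum /braket /= -kraus_part_gram summxE.
by apply: eq_bigr => k _; rewrite /ketbra mxtrace_mulC trace_mx11.
Qed.

Lemma purification_of_density d a (sigma : 'M[C]_d) (psi : 'cV[C]_(d * a)) :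
  density sigma -> ptrace (ketbra psi) = sigma -> purification sigma psi.
Proof.
move=> [_ tr1] eq_sigma; split=> //.
by rewrite /unit_vector -tr_ptrace_ketbra eq_sigma.
Qed.

(** If sigma = B B^*, then sum_k B e_k (x) |k> purifies it. The m zero columns put in front of [B]
    enlarge the ancilla to the dimension used in [operation_dilation]. *)
Lemma purification_exists d m (sigma : 'M[C]_d) :
  density sigma -> exists psi : 'cV[C]_(d * (m + d)), purification sigma psi.
Proof.
move=> dsigma; have [B BE] := psdmx_factor dsigma.1.
pose W : 'M[C]_(d, m + d) := row_mx 0 B.
exists (stack (fun k => col k W)); apply: purification_of_density => //.
rewrite ptrace_ketbraE -BE.
transitivity (W *m W ^t*); last first.
  by rewrite tr_row_mx map_col_mx mul_row_col mul0mx add0r.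
apply/matrixP=> i j; rewrite summxE mxE; apply: eq_bigr => k _.
by rewrite stackK mxE big_ord1 !mxE.
Qed.

(* Zero Kraus operators pad the ancilla to dimension at least [d2], so that it
   also accommodates purifications of the [sigma i] with [eta i = 0]. *)
Lemma operation_dilation d1 d2 (xi : 'M[C]_d1 -> 'M[C]_d2) :
  operation xi ->
  exists m (V : 'M[C]_(d2 * (m + d2), d1)), psdmx (1%:M - V ^t* *m V) /\
    forall v, xi (ketbra v) = ptrace (ketbra (V *m v)).
Proof.
move=> [m [M [psdM xiE]]]; exists m.
pose M' (k : 'I_(m + d2)) := if split k is inl l then M l else 0.
have M'l l : M' (lshift d2 l) = M l by rewrite /M' (unsplitK (inl l)).
have M'r l : M' (rshift m l) = 0 by rewrite /M' (unsplitK (inr l)).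
exists (stack M'); split=> [|v].
  rewrite -kraus_part_gram; under eq_bigr do rewrite stackK.
  rewrite big_split_ord /= [X in _ - (_ + X)]big1 => [|l _];
    last by rewrite M'r mulmx0.
  by rewrite addr0; under eq_bigr do rewrite M'l.
rewrite xiE ptrace_ketbra_mul; under [RHS]eq_bigr do rewrite stackK.
rewrite big_split_ord /= [X in _ + X]big1 => [|l _];
  last by rewrite M'r !mul0mx.
by rewrite addr0; apply: eq_bigr => l _; rewrite M'l.
Qed.

Lemma dilation_operation d1 d2 a (V : 'M[C]_(d2 * a, d1)) :
  psdmx (1%:M - V ^t* *m V) ->
  exists2 xi : 'M[C]_d1 -> 'M[C]_d2, operation xi &
    forall v, xi (ketbra v) = ptrace (ketbra (V *m v)).
Proof.
move=> psdV.
exists (fun rho => \sum_k kraus_part V k *m rho *m (kraus_part V k) ^t*).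
  by exists a, (kraus_part V); rewrite kraus_part_gram.
by move=> v; rewrite ptrace_ketbra_mul.
Qed.

Lemma sqrtC_mul_conj (x : R) : 0 <= x ->
  (Num.sqrt x)%:C * ((Num.sqrt x)%:C : C)^* = x%:C.
Proof.
move=> x0; rewrite [X in _ * X]conjc_real -rmorphM /= -expr2.
by rewrite sqr_sqrtr.
Qed.

(** For x > 0, dividing [u] by sqrt(x) gives psi. For x = 0 the trace forces u = 0, so any
    purification will do, and the ancilla is large enough to contain one. *)
Lemma rescale_purification d m (sigma : 'M[C]_d) (u : 'cV[C]_(d * (m + d)))
    (x : R) :
  density sigma -> 0 <= x -> ptrace (ketbra u) = x%:C *: sigma ->
  exists2 psi, purification sigma psi & (Num.sqrt x)%:C *: psi = u.
Proof.
move=> dsigma x0 uE; have [x_eq0|x_neq0] := eqVneq x 0.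
  have [psi psiP] := purification_exists m dsigma; exists psi => //.
  rewrite x_eq0 sqrtr0 scale0r; apply/esym/braket_eq0.
  by rewrite -tr_ptrace_ketbra uE x_eq0 scale0r mxtrace0.
have s_neq0 : (Num.sqrt x)%:C != 0 :> C.
  by rewrite fmorph_eq0 sqrtr_eq0 -ltNge lt_def x_neq0.
exists (((Num.sqrt x)%:C)^-1 *: u); last by rewrite scalerA divff ?scale1r.
apply: purification_of_density => //.
rewrite ketbra_scale ptrace_scale uE scalerA fmorphV -invfM sqrtC_mul_conj //.
by rewrite mulVf ?scale1r // fmorph_eq0.
Qed.

(** Puts the subtracted term in the form B^* B needed for [contraction_exists]. *)
Lemma scaled_gram_factor d n (psi : 'I_n -> 'cV[C]_d) (eta : 'I_n -> R)
    (V := \matrix_(i, j) ((Num.sqrt (eta j))%:C *: psi j) i ord0) :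
  sqrt_diag eta *m gram psi *m (sqrt_diag eta) ^t* = V ^t* *m V.
Proof.
rewrite gram_factor.
suff -> : V = (\matrix_(i, j) psi j i ord0) *m (sqrt_diag eta) ^t*.
  by rewrite trmxC_mul trmxCK !mulmxA.
rewrite tr_diag_mx map_diag_mx mul_mx_diag; apply/matrixP=> i j.
by rewrite !mxE mulrC; congr (_ * _); rewrite [RHS]conjc_real.
Qed.

End Stinespring.

Theorem lemma2 (R : realType) (d1 d2 n : nat)
    (phi : 'I_n -> 'cV[R[i]]_d1) (sigma : 'I_n -> 'M[R[i]]_d2)
    (eta : 'I_n -> R)
    (phi_unit : forall i, unit_vector (phi i))
    (sigma_density : forall i, density (sigma i))
    (eta01 : forall i, 0 <= eta i <= 1) :
  ((exists xi : 'M[R[i]]_d1 -> 'M[R[i]]_d2, transforms xi phi sigma eta) <->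
   (exists (a : nat) (psi : 'I_n -> 'cV[R[i]]_(d2 * a)),
      (forall i, purification (sigma i) (psi i)) /\
      psdmx (gram phi -
             sqrt_diag eta *m gram psi *m (sqrt_diag eta) ^t*))) /\
  (forall (xi : 'M[R[i]]_d1 -> 'M[R[i]]_d2) (p : 'I_n -> R),
     transforms xi phi sigma eta ->
     (forall i, 0 <= p i) -> \sum_i p i = 1 ->
     whole_success_prob xi p (fun i => ketbra (phi i)) =
       (\sum_i p i * eta i)%:C).
Proof.
have eta_ge0 i : 0 <= eta i by case/andP: (eta01 i).
split; last first.
  move=> xi p [_ xiE] _ _; rewrite /whole_success_prob rmorph_sum /=.
  apply: eq_bigr => i _; rewrite /success_prob xiE mxtraceZ.
  by rewrite (sigma_density i).2 mulr1 rmorphM.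
split=> [[xi [/operation_dilation[m [V [psdV xiV]]] xiE]]|].
  have /fin_all_exists2[psi psiP psiE] i :
      exists2 psi : 'cV[R[i]]_(d2 * (m + d2)), purification (sigma i) psi &
        (Num.sqrt (eta i))%:C *: psi = V *m phi i.
    by apply: rescale_purification; rewrite // -xiV.
  exists (m + d2)%N, psi; split=> //.
  rewrite scaled_gram_factor gram_factor; set A := \matrix_(i, j) phi j i ord0.
  set B := \matrix_(i, j) _; have -> : B = V *m A.
    apply/matrixP=> i j; rewrite mxE psiE !mxE.
    by apply: eq_bigr => k _; rewrite mxE.
  (* A^* A - (V A)^* (V A) = A^* (1 - V^* V) A is a congruence of a positive matrix. *)
  have := psdmx_congr A psdV; rewrite mulmxBr mulmx1 mulmxBl.
  by rewrite trmxC_mul !mulmxA.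
move=> [a [psi [psiP]]]; rewrite scaled_gram_factor gram_factor.
case/contraction_exists=> V VE /dilation_operation[xi xi_op xiV].
exists xi; split=> // i.
(* This is column i of the matrix identity [VE]. *)
have Vphi : V *m phi i = (Num.sqrt (eta i))%:C *: psi i.
  apply/matrixP=> x y; rewrite ord1; have /matrixP/(_ x i) := VE.
  by rewrite !mxE => <-; apply: eq_bigr => k _; rewrite mxE.
by rewrite xiV Vphi ketbra_scale ptrace_scale (psiP i).2 sqrtC_mul_conj.
Qed.
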